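(* Let $(c_\nu)_{\nu\in\mathbb{Z}_{\ge 0}^7}$ be a family of octonions. Suppose that there are constants $r_0, M, N_0\in\mathbb{R}$ such that for all integers $n>N_0$ and all multi-indices $\nu\in\mathbb{Z}_{\ge 0}^7$ with $\|\nu\|=n$ we have $\|c_\nu\|\,r_0^n\le M$. Then the series $$h(x)=\sum_{n=0}^\infty\ \sum_{\substack{\nu=(n_1,\dots,n_7)\\ n_1+\cdots+n_7=n}} V_\nu(x)\, c_\nu$$ converges compactly on $\{x\in O : \|x\|_O'<r_0\}$.
   Context: $O$ denotes the octonions: the real vector space with basis $e_0,e_1,\dots,e_7$ and bilinear product $e_0e_j=e_j$, $e_ie_0=e_i$, and $e_ie_j=-\delta_{ij}e_0+\sum_{k=1}^{7}\varepsilon_{ijk}e_k$ for $i,j\in\{1,\dots,7\}$, where $\delta_{ij}$ is the Kronecker delta and $\varepsilon_{ijk}$ is the completely antisymmetric tensor equal to $+1$ for $ijk=123,145,176,246,257,347,365$ (and $0$ for triples that are not permutations of these). $\|\cdot\|$ is the Euclidean norm on $O\cong\mathbb{R}^8$. For $x=\sum_{i=0}^7 x_ie_i$ and $i\in\{1,\dots,7\}$ put $\zeta_i(x)=x_i-e_ix_0$ (real numbers are identified with multiples of $e_0$). For $\nu=(n_1,\dots,n_7)\in\mathbb{Z}_{\ge0}^7$ put $\|\nu\|=n_1+\cdots+n_7=n$ and $$V_\nu(x)=\frac1{n!}\sum_{(i_1,\dots,i_n)}\bigl(\cdots((\zeta_{i_1}(x)\zeta_{i_2}(x))\zeta_{i_3}(x))\cdots\bigr)\zeta_{i_n}(x),$$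 the sum being over all words $(i_1,\dots,i_n)$ having exactly $n_s$ letters equal to $s$ for each $s=1,\dots,7$, with products bracketed from the left (the product over the empty word is $1$). The auxiliary norm on $O$ is $\|v_0+\sum_{i=1}^7e_iv_i\|_O'=\max_{i\in\{1,\dots,7\}}\|v_i-e_iv_0\|=\max_{i\in\{1,\dots,7\}}\sqrt{v_i^2+v_0^2}$. A series $\sum_n\sum_{\|\nu\|=n}V_\nu c_\nu$ converges compactly on an open set if its partial sums over $n\le N$ converge, as $N\to\infty$, uniformly on every compact subset of that set. *)

(* Defs.v *)
From HB Require Import structures.
From mathcomp Require Import all_boot all_order all_algebra.
From mathcomp Require Import all_classical all_reals all_analysis.
Import Order.TTheory GRing.Theory Num.Theory.
Import numFieldNormedType.Exports.

Set Implicit Arguments.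
Unset Strict Implicit.
Unset Printing Implicit Defensive.

Local Open Scope classical_set_scope.
Local Open Scope ring_scope.

(* Coordinates x_0, ..., x_7 in the basis e_0, ..., e_7.  The library topology
   and uniformity on row vectors are those of the sup norm, which coincide
   with those of the Euclidean norm. *)
Notation octonion R := 'rV[R]_8.

Section Octonions.
Variable R : realType.

Definition oct_e (i : 'I_8) : octonion R := delta_mx ord0 i.

Definition oct_real (a : R) : octonion R := a *: oct_e ord0.

Definition oct_triples : seq (nat * nat * nat) :=
  [:: (1, 2, 3); (1, 4, 5); (1, 7, 6); (2, 4, 6);
      (2, 5, 7); (3, 4, 7); (3, 6, 5)]%N.

(* Even permutations of three letters are the cyclic ones; the odd ones are
   the cyclic permutations of the triple with two letters exchanged. *)
Definition oct_cyclic (i j k : nat) : bool :=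
  [|| (i, j, k) \in oct_triples, (j, k, i) \in oct_triples
    | (k, i, j) \in oct_triples].

Definition oct_eps (i j k : nat) : R :=
  if oct_cyclic i j k then 1 else if oct_cyclic j i k then -1 else 0.

Definition oct_e_mul (i j : 'I_8) : octonion R :=
  if i == ord0 then oct_e j
  else if j == ord0 then oct_e i
  else - ((i == j)%:R *: oct_e ord0)
       + \sum_(k < 8 | k != ord0) oct_eps i j k *: oct_e k.

Definition oct_mul (x y : octonion R) : octonion R :=
  \sum_(i < 8) \sum_(j < 8) (x ord0 i * y ord0 j) *: oct_e_mul i j.

Definition oct_norm (x : octonion R) : R :=
  Num.sqrt (\sum_(i < 8) x ord0 i ^+ 2).

(* An index s : 'I_7 stands for the imaginary unit e_(s+1); the corresponding
   element of 'I_8 is [lift ord0 s]. *)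
Definition oct_zeta (s : 'I_7) (x : octonion R) : octonion R :=
  oct_real (x ord0 (lift ord0 s))
  - oct_mul (oct_e (lift ord0 s)) (oct_real (x ord0 ord0)).

(* ||v||'_O; the norms are nonnegative, so 0 is neutral for their maximum. *)
Definition oct_norm' (v : octonion R) : R :=
  \big[Num.max/0]_(s < 7) oct_norm (oct_zeta s v).

Definition multi_index := {ffun 'I_7 -> nat}.

Definition mi_norm (nu : multi_index) : nat := (\sum_(s < 7) nu s)%N.

Definition oct_word (x : octonion R) (w : seq 'I_7) : octonion R :=
  foldl (fun p s => oct_mul p (oct_zeta s x)) (oct_real 1) w.

Definition oct_V (nu : multi_index) (x : octonion R) : octonion R :=
  ((mi_norm nu)`!%:R)^-1 *:
    \sum_(w : (mi_norm nu).-tuple 'I_7 | [forall s, count_mem s w == nu s])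
      oct_word x w.

Definition mi_of_ord (n : nat) (mu : {ffun 'I_7 -> 'I_n.+1}) : multi_index :=
  [ffun s => nat_of_ord (mu s)].

(* The multi-indices of norm n have all their entries at most n, hence are
   enumerated, each once, by the maps from 'I_7 to 'I_n.+1 of norm n. *)
Definition oct_homog (c : multi_index -> octonion R) (n : nat)
    (x : octonion R) : octonion R :=
  \sum_(mu : {ffun 'I_7 -> 'I_n.+1} | mi_norm (mi_of_ord mu) == n)
    oct_mul (oct_V (mi_of_ord mu) x) (c (mi_of_ord mu)).

Definition oct_partial_sum (c : multi_index -> octonion R) (N : nat)
    (x : octonion R) : octonion R :=
  \sum_(n < N.+1) oct_homog c n x.

Definition converges_compactly (U : set (octonion R))
    (f : nat -> octonion R -> octonion R) : Prop :=
  exists h : octonion R -> octonion R,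
    forall K : set (octonion R), compact K -> K `<=` U ->
      {uniform K, f @ \oo --> h}.

End Octonions.

(* Main.v *)
Require Import Defs.
From HB Require Import structures.
From mathcomp Require Import all_boot all_order all_algebra.
From mathcomp Require Import all_classical all_reals all_analysis.
From mathcomp Require Import ring.
Import Order.TTheory GRing.Theory Num.Theory.
Import numFieldNormedType.Exports.

Local Open Scope classical_set_scope.
Local Open Scope ring_scope.

(** Every word of length n has norm at most a constant times (C r0)^n on the
    domain, where C bounds the product.  The 1/n! in V_nu, against at most 7^n
    words, at most (n+1)^7 <= 2^(7n) multi-indices and coefficients bounded by
    M / r0^n, dominates the homogeneous part of degree n by a constant times
    (2^7 * 7 * C)^n / n!; the powers of r0 cancel.  The Weierstrass M-test
    against an exponential series then gives convergence uniformly on the whole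
    domain. *)

(* Makes matrices canonically a [completeNormedModType]. *)
HB.instance Definition _ (R : realType) (m n : nat) :=
  NormedModule.on 'M[R]_(m, n).

(** Past the index where domination starts, blocks of [series b] bound those of the function series
    uniformly on [A]. Completeness of [V] gives pointwise limits, and sending the upper end of a
    block to infinity makes the convergence uniform. *)
Lemma weierstrass_M_test (R : realType) (T : choiceType)
    (V : completeNormedModType R) (A : set T) (f : nat -> T -> V)
    (b : R ^nat) :
  (\forall n \near \oo, forall x, A x -> `|f n x| <= b n) ->
  cvgn (series b) ->
  {uniform A, (fun n x => series (f ^~ x) n) @ \oo
              --> (fun x => limn (series (f ^~ x)))}.
Proof.
move=> [k _ fb] /cauchy_cvgP/cauchy_seriesP b_cauchy.
have tail (e : R) : 0 < e -> exists N, forall m n x,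
    (N <= m)%N -> (N <= n)%N -> A x -> `|\sum_(m <= i < n) f i x| < e.
  move=> /b_cauchy[[P Q] [[p _ pP] [q _ qQ]] PQ].
  exists (maxn k (maxn p q)) => m n x.
  rewrite !geq_max => /and3P[km pm _] /and3P[_ _ qn] Ax.
  apply: le_lt_trans (PQ (m, n) (conj (pP _ pm) (qQ _ qn))).
  rewrite (le_trans (ler_norm_sum _ _ _))// (le_trans _ (ler_norm _))//.
  apply: ler_sum_nat => i /andP[mi _].
  by apply: fb => //; exact: leq_trans mi.
have cvgf x : A x -> cvgn (series (f ^~ x)).
  move=> Ax; apply/cauchy_cvgP/cauchy_seriesP => e /tail[N tailN].
  exists ([set n | N <= n]%N, [set n | N <= n]%N); first by split; exists N.
  by case=> m n [/= Nm Nn]; exact: tailN.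
move=> P /uniform_nbhs[E [+ EP]]; rewrite -entourage_ballE => -[e /= e0 eE].
(* Passing to the limit keeps only a weak inequality, so [e / 2] is used to end strictly below
   [e]. *)
have [N tailN] := tail _ (divr_gt0 e0 (ltr0n _ 2)).
exists N => // n /= Nn; apply: EP => x Ax; apply: eE => /=.
rewrite -ball_normE /= (@le_lt_trans _ _ (e / 2))//; last first.
  by rewrite ltr_pdivrMr// ltr_pMr// ltr1n.
have cvgfn : `|series (f ^~ x) m - series (f ^~ x) n| @[m --> \oo] -->
    `|limn (series (f ^~ x)) - series (f ^~ x) n|.
  by apply: cvg_norm; apply: cvgB; [exact: cvgf|exact: cvg_cst].
apply: (cvgr_to_le cvgfn); exists n => // m /= nm.
by rewrite sub_series nm ltW// tailN// (leq_trans Nn).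
Qed.

(** Carries Euclidean bounds on the zetas and the coefficients over to the sup norm [|x|], in which
    all later estimates are made. *)
Lemma mx_norm_le_oct_norm (R : realType) (x : octonion R) : `|x| <= oct_norm x.
Proof.
rewrite /Num.norm/= mx_normrE; apply: bigmax_le => [|[i j] _ /=].
  exact: sqrtr_ge0.
rewrite (ord1 i) -sqrtr_sqr; apply: ler_wsqrtr.
by rewrite (bigD1 j)//= lerDl sumr_ge0// => l _; exact: sqr_ge0.
Qed.

(* The multiplicativity of the Euclidean norm is not needed: the factorial in
   [oct_V] beats any geometric growth of the words. *)
Definition oct_mul_const (R : realType) : R :=
  \sum_(i < 8) \sum_(j < 8) `|oct_e_mul R i j|.

Lemma oct_mul_const_ge0 (R : realType) : 0 <= oct_mul_const R.
Proof. by do 2!apply: sumr_ge0 => ? _. Qed.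

#[local] Hint Extern 0 (is_true (0 <= oct_mul_const _)) =>
  exact: oct_mul_const_ge0 : core.

Lemma norm_oct_mul_le (R : realType) (x y : octonion R) :
  `|oct_mul x y| <= oct_mul_const R * (`|x| * `|y|).
Proof.
rewrite mulr_suml (le_trans (ler_norm_sum _ _ _))//.
apply: ler_sum => i _; rewrite mulr_suml (le_trans (ler_norm_sum _ _ _))//.
apply: ler_sum => j _; rewrite normrZ normrM mulrC ler_wpM2l//.
have coord (z : octonion R) l : `|z ord0 l| <= `|z|.
  by rewrite /Num.norm/= mx_normrE;
    exact: (le_bigmax_cond (j := (ord0, l)) _ (fun i => `|z i.1 i.2|)).
by apply: ler_pM.
Qed.

Lemma oct_norm'_ge0 (R : realType) (x : octonion R) : 0 <= oct_norm' x.
Proof. exact: bigmax_ge_id. Qed.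

Lemma norm_oct_zeta_le (R : realType) (x : octonion R) (s : 'I_7) :
  `|oct_zeta s x| <= oct_norm' x.
Proof.
apply: le_trans (mx_norm_le_oct_norm _ _) _.
exact: (le_bigmax_cond _ (fun s => oct_norm (oct_zeta s x))).
Qed.

(** Bracketing from the left makes each new letter a single right multiplication by a zeta, hence
    the induction from the right end. *)
Lemma norm_oct_word_le (R : realType) (x : octonion R) (w : seq 'I_7) :
  `|oct_word x w| <=
    `|oct_real (1 : R)| * (oct_mul_const R * oct_norm' x) ^+ size w.
Proof.
elim/last_ind: w => [|w s IH]; first by rewrite expr0 mulr1.
rewrite /oct_word foldl_rcons -/(oct_word x w) size_rcons exprSr.
apply: le_trans (norm_oct_mul_le _ _ _) _.
set X := oct_mul_const R * oct_norm' x in IH *.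
have -> : `|oct_real (1 : R)| * (X ^+ size w * X) =
    oct_mul_const R * (`|oct_real (1 : R)| * X ^+ size w * oct_norm' x).
  by rewrite /X; ring.
by rewrite ler_wpM2l// ler_pM// norm_oct_zeta_le.
Qed.

Lemma norm_oct_V_le (R : realType) (nu : multi_index) (x : octonion R) :
  `|oct_V nu x| <=
    `|oct_real (1 : R)| *
    ((7 * oct_mul_const R * oct_norm' x) ^+ mi_norm nu / (mi_norm nu)`!%:R).
Proof.
set n := mi_norm nu.
rewrite normrZ ger0_norm ?invr_ge0 ?ler0n// mulrC mulrA ler_pM2r; last first.
  by rewrite invr_gt0 ltr0n fact_gt0.
rewrite (le_trans (ler_norm_sum _ _ _))//.
(* Dropping the condition on letter counts leaves all 7^n words of length n. *)
rewrite (@le_trans _ _ (\sum_(w : n.-tuple 'I_7)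
  `|oct_real (1 : R)| * (oct_mul_const R * oct_norm' x) ^+ n))//.
  rewrite big_mkcond/= ler_sum// => w _; case: ifP => _; last first.
    by rewrite mulr_ge0// exprn_ge0// mulr_ge0// oct_norm'_ge0.
  by rewrite (le_trans (norm_oct_word_le _ _ _))// size_tuple.
rewrite sumr_const card_tuple card_ord -mulrnAr -mulr_natl natrX.
by rewrite -exprMn mulrA.
Qed.

Lemma norm_oct_homog_le (R : realType) (M r : R) (c : multi_index -> octonion R)
    (n : nat) (x : octonion R) :
  0 <= M ->
  (forall nu, mi_norm nu = n -> oct_norm (c nu) * r ^+ n <= M) ->
  oct_norm' x < r ->
  `|oct_homog c n x| <=
    oct_mul_const R * `|oct_real (1 : R)| * M *
    exp_coeff (2 ^+ 7 * 7 * oct_mul_const R) n.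
Proof.
move=> M0 cM xr.
(* The point [x] of the domain forces [r] to be positive, which allows division by r^n. *)
have r0 : 0 < r := le_lt_trans (oct_norm'_ge0 _ x) xr.
have term (mu : {ffun 'I_7 -> 'I_n.+1}) : mi_norm (mi_of_ord mu) = n ->
    `|oct_mul (oct_V (mi_of_ord mu) x) (c (mi_of_ord mu))| <=
    oct_mul_const R * `|oct_real (1 : R)| * M *
    ((7 * oct_mul_const R) ^+ n / n`!%:R).
  move=> mun; rewrite (le_trans (norm_oct_mul_le _ _ _))// -!mulrA ler_wpM2l//.
  (* Insert r^n / r^n: the numerator goes to the bound on V_nu, the denominator to the bound on the
     coefficient. *)
  have -> : `|oct_real (1 : R)| * (M * ((7 * oct_mul_const R) ^+ n / n`!%:R)) =
      `|oct_real (1 : R)| * ((7 * oct_mul_const R * r) ^+ n / n`!%:R) *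
      (M / r ^+ n).
    rewrite !exprMn; field.
    by rewrite pnatr_eq0 -lt0n fact_gt0 expf_neq0// gt_eqF.
  apply: ler_pM => //.
    rewrite (le_trans (norm_oct_V_le _ _ _))// mun ler_wpM2l//.
    rewrite ler_wpM2r ?invr_ge0 ?ler0n// lerXn2r ?nnegrE ?mulr_ge0//.
    - exact: oct_norm'_ge0.
    - exact: ltW.
    - by rewrite ler_wpM2l ?mulr_ge0// ltW.
  rewrite ler_pdivlMr ?exprn_gt0// (le_trans _ (cM _ mun))//.
  by rewrite ler_wpM2r ?mx_norm_le_oct_norm// exprn_ge0// ltW.
rewrite (le_trans (ler_norm_sum _ _ _))//.
rewrite (le_trans (ler_sum _ (fun mu mun => term mu (eqP mun))))//.
rewrite sumr_const -mulrnAr ler_wpM2l ?mulr_ge0// -mulr_natl mulrA.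
rewrite /exp_coeff/= ler_wpM2r ?invr_ge0 ?ler0n//.
rewrite -[in leRHS]mulrA [in leRHS]exprMn.
rewrite ler_wpM2r ?exprn_ge0 ?mulr_ge0// -exprM mulnC exprM -!natrX ler_nat.
(* The indices lie among (n+1)^7 functions, and n + 1 <= 2^n. *)
apply: leq_trans (max_card _) _.
by rewrite card_ffun !card_ord leq_exp2r// ltn_expl.
Qed.

Theorem theorem5p0p3 (R : realType) (c : multi_index -> octonion R)
    (r0 M N0 : R)
    (hc : forall (n : nat) (nu : multi_index),
        N0 < n%:R -> mi_norm nu = n -> oct_norm (c nu) * r0 ^+ n <= M) :
  converges_compactly [set x : octonion R | oct_norm' x < r0]
    (oct_partial_sum c).
Proof.
set U := [set x : octonion R | oct_norm' x < r0].
have cvgU : {uniform U, (fun n x => series (oct_homog c ^~ x) n) @ \oo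
    --> (fun x => limn (series (oct_homog c ^~ x)))}.
  (* The sign of [M] is unknown, while [norm_oct_homog_le] asks for a nonnegative bound. *)
  pose D := oct_mul_const R * `|oct_real (1 : R)| * `|M|.
  apply: (@weierstrass_M_test R _ 'rV[R]_8 U (oct_homog c)
    (D *: exp_coeff (2 ^+ 7 * 7 * oct_mul_const R))); last first.
    by apply: is_cvg_seriesZ; exact: is_cvg_series_exp_coeff.
  near=> n => x Ux; apply: norm_oct_homog_le Ux => // nu nun.
  apply: le_trans (ler_norm _); apply: hc => //.
  by near: n; exact: nbhs_infty_gtr.
exists (fun x => limn (series (oct_homog c ^~ x))) => K _ KU.
apply: uniform_subset_cvg KU _.
(* [series] at n stops before degree n, whereas [oct_partial_sum] includes it. *)
have -> : oct_partial_sum c = (fun n x => series (oct_homog c ^~ x) n) \o S.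
  by apply/funext => n; apply/funext => x; rewrite /series/= big_mkord.
apply: cvg_comp cvgU.
by move=> P [N _ NP]; exists N => // n Nn; apply: NP; exact: leqW.
Unshelve. all: by end_near. Qed.
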